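(* Let $\mathfrak{K}=\mathbb{Q}(p_1,\dots,p_\ell)$, let $R=\mathfrak{K}[x_1,\dots,x_n]$, and let $h_1,\dots,h_n\in R$ generate an ideal $I=\langle h_1,\dots,h_n\rangle\subset R$ that is generically radical and zero-dimensional. Fix $d\ge 0$, $p^*\in\mathbb{C}^\ell$, points $q_1,\dots,q_k\in\mathbb{C}^n$, and let $S_d(q_1,\dots,q_k)$ be a $k\times k$ submatrix of $M_d(q_1,\dots,q_k)$, obtained by selecting $k$ fixed columns; write $S_d(y_1,\dots,y_k)$ for the same column selection applied to $M_d(y_1,\dots,y_k)$. Let $G_{p^*}(x)=[h_{1,p^*}(x),\dots,h_{n,p^*}(x)]^T$. Suppose the well-constrained polynomial system in the unknowns $y_1,\dots,y_k\in\mathbb{C}^n$ and $\Lambda\in\mathbb{C}^{k\times k}$, $$\mathcal{G}(y_1,\dots,y_k,\Lambda)=\begin{bmatrix}G_{p^*}(y_1)\\ \vdots\\ G_{p^*}(y_k)\\ \Lambda\cdot S_d(y_1,\dots,y_k)-\mathbf{I}\end{bmatrix},$$ where $\mathbf{I}$ is the $k\times k$ identity matrix, has a nonsingular solution. Then $\mathrm{HF}_I(d)\ge k$.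
   Context: $\mathbb{Q}(p_1,\dots,p_\ell)$ is the field of rational functions in parameters $p=(p_1,\dots,p_\ell)$ with rational coefficients. For $h\in R$ and $p^*\in\mathbb{C}^\ell$, $h_{p^*}\in\mathbb{C}[x_1,\dots,x_n]$ denotes the polynomial obtained by specializing $p$ to $p^*$ (when all coefficients of $h$ are defined at $p^*$). $I$ is generically radical and zero-dimensional means: for general $p^*\in\mathbb{C}^\ell$, the ideal $I_{p^*}=\langle h_{1,p^*},\dots,h_{n,p^*}\rangle\subset\mathbb{C}[x_1,\dots,x_n]$ satisfies $\#\mathcal{V}(I_{p^*})=\deg I_{p^*}<\infty$. For $d\ge0$, $I_{\le d}$ denotes the $\mathfrak{K}$-vector space of polynomials in $I$ of degree at most $d$, and the affine Hilbert function is $\mathrm{HF}_I(d)=\binom{n+d}{d}-\dim_{\mathfrak{K}}(I_{\le d})$. The degree-$\le d$ Veronese map $\nu_d:\mathbb{C}^n\to\mathbb{C}^{\binom{n+d}{d}}$ sends $x$ to the row vector of all monomials in $x_1,\dots,x_n$ of degree at most $d$ (in a fixed order), and $M_d(y_1,\dots,y_k)$ is the $k\times\binom{n+d}{d}$ matrix whose $j$-th row is $\nu_d(y_j)$. A solution is nonsingular if the Jacobian of the system at it is invertible. *)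

(* Defs.v *)
From HB Require Import structures.
From mathcomp Require Import all_boot all_algebra.
From mathcomp Require Import Rstruct complex mpoly fraction.
From Stdlib Require Import ClassicalEpsilon.
Set Implicit Arguments. Unset Strict Implicit. Unset Printing Implicit Defensive.
Import GRing.Theory Num.Theory.
Local Open Scope ring_scope.

Definition CC : numClosedFieldType := (Rdefinitions.R)[i].

Definition Kfield (l : nat) : fieldType := {fraction {mpoly rat[l]}}.

Definition peval (l : nat) (a : {mpoly rat[l]}) (ps : 'I_l -> CC) : CC :=
  (map_mpoly (ratr : rat -> CC) a).@[ps].

Definition coef_value (l : nat) (ps : 'I_l -> CC) (c : Kfield l) (v : CC) : Prop :=
  exists a b : {mpoly rat[l]},
    [/\ c = (tofrac a / tofrac b : Kfield l), peval b ps != 0 & v = peval a ps / peval b ps].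

Definition coef_defined_at (l : nat) (ps : 'I_l -> CC) (c : Kfield l) : Prop :=
  exists v, coef_value ps c v.

(* Specialization of a coefficient at p* (junk value when undefined). *)
Definition spec_coef (l : nat) (ps : 'I_l -> CC) (c : Kfield l) : CC :=
  epsilon (inhabits 0) (coef_value ps c).

Definition poly_defined_at (l n : nat) (ps : 'I_l -> CC) (h : {mpoly (Kfield l)[n]}) : Prop :=
  forall m, coef_defined_at ps (h@_m).

Definition spec_poly (l n : nat) (ps : 'I_l -> CC) (h : {mpoly (Kfield l)[n]})
  : {mpoly CC[n]} := map_mpoly (spec_coef ps) h.

Definition in_ideal (F : fieldType) (n r : nat) (G : 'I_r -> {mpoly F[n]})
  (f : {mpoly F[n]}) : Prop :=
  exists g : 'I_r -> {mpoly F[n]}, f = \sum_(i < r) g i * G i.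

Definition num_zeros (n r : nat) (G : 'I_r -> {mpoly CC[n]}) (m : nat) : Prop :=
  exists z : 'I_m -> ('I_n -> CC),
    [/\ injective z,
        forall j i, (G i).@[z j] = 0 &
        forall x : 'I_n -> CC, (forall i, (G i).@[x] = 0) -> exists j, z j = x].

Definition quot_dim (n r : nat) (G : 'I_r -> {mpoly CC[n]}) (m : nat) : Prop :=
  exists b : 'I_m -> {mpoly CC[n]},
    (forall f : {mpoly CC[n]}, exists c : 'I_m -> CC,
        in_ideal G (f - \sum_(j < m) c j *: b j)) /\
    (forall c : 'I_m -> CC, in_ideal G (\sum_(j < m) c j *: b j) -> forall j, c j = 0).

(* I = <h_1..h_r> is generically radical and zero-dimensional: outside a proper
   Zariski-closed subset of C^l, h_{p*} is defined and #V(I_{p*}) = deg I_{p*} < oo. *)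
Definition generically_radical_zerodim (l n r : nat) (h : 'I_r -> {mpoly (Kfield l)[n]}) : Prop :=
  exists D : {mpoly CC[l]}, D != 0 /\
    forall ps : 'I_l -> CC, D.@[ps] != 0 ->
      (forall i, poly_defined_at ps (h i)) /\
      exists m : nat, num_zeros (fun i => spec_poly ps (h i)) m /\
                      quot_dim (fun i => spec_poly ps (h i)) m.

Definition is_dim_Ile (F : fieldType) (n r : nat) (h : 'I_r -> {mpoly F[n]}) (d m : nat) : Prop :=
  exists b : 'I_m -> {mpoly F[n]},
    [/\ forall j, in_ideal h (b j) /\ (msize (b j) <= d.+1)%N,
        forall c : 'I_m -> F, \sum_(j < m) c j *: b j = 0 -> forall j, c j = 0 &
        forall f, in_ideal h f -> (msize f <= d.+1)%N ->
          exists c : 'I_m -> F, f = \sum_(j < m) c j *: b j].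

Definition dim_Ile (F : fieldType) (n r : nat) (h : 'I_r -> {mpoly F[n]}) (d : nat) : nat :=
  epsilon (inhabits 0%N) (is_dim_Ile h d).

Definition HF (F : fieldType) (n r : nat) (h : 'I_r -> {mpoly F[n]}) (d : nat) : nat :=
  ('C(n + d, d) - dim_Ile h d)%N.

Definition nvars (k n : nat) : nat := (k * n + k * k)%N.

Definition yvar (k n : nat) (j : 'I_k) (t : 'I_n) : 'I_(nvars k n) :=
  lshift (k * k) (mxvec_index j t).

Definition lamvar (k n : nat) (a b : 'I_k) : 'I_(nvars k n) :=
  rshift (k * n) (mxvec_index a b).

Definition S_entry (k n d : nat) (sel : 'I_k -> 'X_{1..n < d.+1}) (c b : 'I_k)
  : {mpoly CC[nvars k n]} :=
  \prod_(t < n) 'X_(yvar c t) ^+ (sel b : 'X_{1..n}) t.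

Definition big_system (l n k d : nat) (ps : 'I_l -> CC) (h : 'I_n -> {mpoly (Kfield l)[n]})
  (sel : 'I_k -> 'X_{1..n < d.+1}) : 'rV[{mpoly CC[nvars k n]}]_(nvars k n) :=
  row_mx
    (mxvec (\matrix_(j < k, i < n)
       (spec_poly ps (h i) \mPo [tuple 'X_(yvar j t) | t < n])))
    (mxvec (\matrix_(a < k, b < k)
       (\sum_(c < k) 'X_(lamvar n a c) * S_entry sel c b - (a == b)%:R))).

Definition nonsingular_solution (N : nat) (F : 'rV[{mpoly CC[N]}]_N) (z : 'I_N -> CC) : Prop :=
  (forall e, (F ord0 e).@[z] = 0) /\
  \det (\matrix_(e < N, v < N) (mderiv v (F ord0 e)).@[z]) != 0.

(* Main.v *)
Require Import Defs.
From HB Require Import structures.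
From mathcomp Require Import all_boot all_algebra.
From mathcomp Require Import Rstruct complex mpoly fraction.
From mathcomp Require Import ring.
From Stdlib Require Import Classical ClassicalEpsilon.
Set Implicit Arguments. Unset Strict Implicit. Unset Printing Implicit Defensive.
Import GRing.Theory Num.Theory.
Local Open Scope ring_scope.

(* The selected monomials are linearly independent modulo I, which bounds
   dim I_{<= d} by C(n + d, d) - k.  Suppose a nontrivial combination
   sum_b c_b x^(m_b) lies in I.  After clearing denominators (those of the h_i by
   polynomials that do not vanish at p^* ), restrict the parameters to a line
   p^* + t v on which some coefficient a_b does not vanish identically.  The
   system being nonsingular, each y_j is a nonsingular zero of G_{p^*}, so for
   every N it lifts by Newton iteration to a zero Y_j(t) modulo t^N of the
   restricted system; hence S_d(Y) a = 0 modulo t^N.  As det S_d(Y) is nonzero at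
   t = 0, Cramer's rule gives t^N | a_b for all N, so every a_b vanishes. *)

(** * Multivariate polynomials: Taylor expansion, change of coefficients, chain rule *)

Lemma mpoly_ring_ind (R : comNzRingType) (n : nat) (P : {mpoly R[n]} -> Prop) :
  (forall c, P c%:MP) -> (forall i, P 'X_i) ->
  (forall p q, P p -> P q -> P (p + q)) ->
  (forall p q, P p -> P q -> P (p * q)) -> forall p, P p.
Proof.
move=> PC PX PD PM.
have PXm m : P 'X_[m].
  rewrite mpolyXE_id; apply: big_ind => // [|i _]; first exact: (PC 1).
  by elim: (m i) => [|e IH]; [exact: (PC 1) | rewrite exprS; apply: PM].
elim/mpolyind => [|c m p _ _ IH]; first exact: (PC 0).
by rewrite -mul_mpolyC; apply: PD => //; apply: PM.
Qed.

(** The remainder is left existential: the Newton step, with [s] a power of ['X], uses only that it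
    carries the factor [s ^+ 2]. *)
Lemma meval_taylor2 (R : comNzRingType) (n : nat) (p : {mpoly R[n]})
    (y u : 'I_n -> R) (s : R) :
  exists r, p.@[fun i => y i + s * u i]
    = p.@[y] + s * (\sum_i p^`M(i).@[y] * u i) + s ^+ 2 * r.
Proof.
pose P (p : {mpoly R[n]}) := exists r, p.@[fun i => y i + s * u i]
  = p.@[y] + s * (\sum_i p^`M(i).@[y] * u i) + s ^+ 2 * r.
have PC c : P c%:MP.
  exists 0; rewrite !mevalC big1 ?mulr0 ?addr0 // => i _.
  by rewrite mderivC meval0 mul0r.
have PD p1 p2 : P p1 -> P p2 -> P (p1 + p2).
  move=> [r1 e1] [r2 e2]; exists (r1 + r2).
  under eq_bigr do rewrite mderivD mevalD mulrDl.
  rewrite big_split /= !mevalD e1 e2; ring.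
have PM p1 p2 : P p1 -> P p2 -> P (p1 * p2).
  move=> [r1 e1] [r2 e2]; rewrite /P.
  under eq_bigr do rewrite mderivM mevalD !mevalM mulrDl.
  rewrite big_split /= !mevalM e1 e2.
  have -> : \sum_i p1^`M(i).@[y] * p2.@[y] * u i
      = p2.@[y] * \sum_i p1^`M(i).@[y] * u i.
    by rewrite big_distrr /=; apply: eq_bigr => i _; ring.
  have -> : \sum_i p1.@[y] * p2^`M(i).@[y] * u i
      = p1.@[y] * \sum_i p2^`M(i).@[y] * u i.
    by rewrite big_distrr /=; apply: eq_bigr => i _; ring.
  set d1 := \sum_i _; set d2 := \sum_i _.
  exists (p1.@[y] * r2 + p2.@[y] * r1 + d1 * d2 + s * (d1 * r2 + d2 * r1)
          + s ^+ 2 * r1 * r2); ring.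
have PX i : P 'X_i.
  exists 0; rewrite !mevalXU (bigD1 i) //= big1 => [|j ji].
    rewrite mderivX mnm1E eqxx -{1}[U_(i)%MM]add0m addmK mpolyX0 scale1r meval1; ring.
  by rewrite mderivX mnm1E eq_sym (negPf ji) scale0r meval0 mul0r.
exact: (mpoly_ring_ind PC PX PD PM).
Qed.

Lemma rmorph_meval (R S : comNzRingType) (f : {rmorphism R -> S}) (n : nat)
    (p : {mpoly R[n]}) (y : 'I_n -> R) :
  f p.@[y] = (map_mpoly f p).@[f \o y].
Proof.
elim/mpoly_ring_ind: p => [c|i|p1 p2 e1 e2|p1 p2 e1 e2].
- by rewrite map_mpolyC !mevalC.
- by rewrite map_mpolyX !mevalXU.
- by rewrite mevalD !rmorphD /= e1 e2.
- by rewrite mevalM !rmorphM /= e1 e2.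
Qed.

Lemma mderiv_map_mpoly (R S : nzRingType) (f : {rmorphism R -> S}) (n : nat)
    (p : {mpoly R[n]}) (i : 'I_n) :
  map_mpoly f p^`M(i) = (map_mpoly f p)^`M(i).
Proof.
by apply/mpolyP => m; rewrite mcoeff_deriv !mcoeff_map_mpoly mcoeff_deriv /= rmorphMn.
Qed.

(** Stated for a bare function [f], since [spec_coef] is defined by choice and does not come as a
    morphism. *)
Lemma mcoeff_map_mpoly_msupp (R S : nzRingType) (f : R -> S) (n : nat)
    (p : {mpoly R[n]}) (m : 'X_{1..n}) :
  (map_mpoly f p)@_m = if m \in msupp p then f p@_m else 0.
Proof.
rewrite /map_mpoly /mmap raddf_sum /=.
under eq_bigr do rewrite mmap1_id mul_mpolyC mcoeffZ mcoeffX.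
case: ifP => hm.
  rewrite (bigD1_seq m) ?msupp_uniq //= eqxx mulr1 big1 ?addr0 // => m' /negPf ->.
  by rewrite mulr0.
rewrite big1_seq // => m' /andP[_ hm'].
by case: eqP hm' hm => [->|]; rewrite ?mulr0 // => ->.
Qed.

Lemma map_mpoly_inj (R S : nzRingType) (f : {rmorphism R -> S}) (n : nat) :
  injective f -> injective (map_mpoly f : {mpoly R[n]} -> {mpoly S[n]}).
Proof.
move=> f_inj p q /mpolyP e; apply/mpolyP => m; apply: f_inj.
by rewrite -!mcoeff_map_mpoly.
Qed.

Lemma mpoly_of_coef (R : nzRingType) (n k : nat) (A : 'X_{1..n} -> R) :
  (forall m, (k <= mdeg m)%N -> A m = 0) ->
  exists p : {mpoly R[n]}, forall m, p@_m = A m.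
Proof.
move=> Ak; exists (\sum_(m : 'X_{1..n < k}) A m *: 'X_[m]) => m.
have [lt|ge] := ltnP (mdeg m) k; first by rewrite mcoeff_mpoly.
rewrite Ak // raddf_sum big1 //= => i _; rewrite mcoeffZ mcoeffX.
by case: eqP => [e|]; rewrite ?mulr0 //; move: ge; rewrite -e leqNgt bmdeg.
Qed.

Lemma mderiv_comp_mpoly (R : comNzRingType) (n N : nat) (p : {mpoly R[n]})
    (q : n.-tuple {mpoly R[N]}) (v : 'I_N) :
  (p \mPo q)^`M(v) = \sum_t (p^`M(t) \mPo q) * (tnth q t)^`M(v).
Proof.
elim/mpoly_ring_ind: p => [c|i|p1 p2 e1 e2|p1 p2 e1 e2].
- by rewrite comp_mpolyC mderivC big1 // => t _; rewrite mderivC comp_mpoly0 mul0r.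
- rewrite comp_mpolyXU -tnth_nth (bigD1 i) //= big1 => [|t ti].
    rewrite mderivX mnm1E eqxx -{1}[U_(i)%MM]add0m addmK mpolyX0 scale1r.
    by rewrite comp_mpoly1 mul1r addr0.
  by rewrite mderivX mnm1E eq_sym (negPf ti) scale0r comp_mpoly0 mul0r.
- rewrite comp_mpolyD mderivD e1 e2 -big_split /=; apply: eq_bigr => t _.
  by rewrite mderivD comp_mpolyD mulrDl.
- rewrite rmorphM mderivM e1 e2 big_distrl big_distrr -big_split /=.
  by apply: eq_bigr => t _; rewrite mderivM raddfD /= !rmorphM /=; ring.
Qed.

(** * Newton lifting of nonsingular zeros *)

Lemma dvd_polyX (F : fieldType) (p : {poly F}) : ('X %| p) = (p.[0] == 0).
Proof. by rewrite -[X in X %| _]subr0 dvdp_XsubCl. Qed.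

(** Newton iteration with the Jacobian frozen at ['X = 0]: each step gains one power of ['X].
    Polynomials can stand for power series, as only residues modulo ['X^N] matter. *)
Lemma hensel_poly (F : fieldType) (n : nat) (H : 'I_n -> {mpoly {poly F}[n]})
    (y : 'I_n -> F) :
  (forall i, (map_mpoly (horner_eval 0) (H i)).@[y] = 0) ->
  \matrix_(i, t) (map_mpoly (horner_eval 0) (H i))^`M(t).@[y] \in unitmx ->
  forall N, exists Y : 'I_n -> {poly F},
    (forall t, (Y t).[0] = y t) /\ (forall i, 'X^N %| (H i).@[Y]).
Proof.
set J := \matrix_(i, t) _ => Hy Junit.
have ev0 p (Y : 'I_n -> {poly F}) : (forall t, (Y t).[0] = y t) ->
    p.@[Y].[0] = (map_mpoly (horner_eval 0) p).@[y].
  move=> eY; rewrite -[LHS]/(horner_eval 0 _) rmorph_meval.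
  by apply: meval_eq => t; rewrite -eY.
elim=> [|[_|N [Y [eY]]]].
- exists (fun t => (y t)%:P); split=> [t|i]; first by rewrite hornerC.
  by rewrite expr0 dvd1p.
- exists (fun t => (y t)%:P); have eY t : (y t)%:P.[0] = y t by rewrite hornerC.
  by split=> // i; rewrite expr1 dvd_polyX ev0 ?Hy.
(* With M >= 1, the quadratic remainder, a multiple of X^(2M), is divisible by X^(M+1), and a
   correction by X^M preserves Y(0) = y. *)
set M := N.+1 => dvd.
pose q i : {poly F} := (H i).@[Y] %/ 'X^M.
have eq i : (H i).@[Y] = q i * 'X^M by rewrite divpK.
(* [u] solves J u = - q(0), which cancels the coefficient of X^M. *)
pose u : 'cV[F]_n := - (invmx J *m \col_i (q i).[0]).
exists (fun t => Y t + 'X^M * (u t 0)%:P); split=> [t|i].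
  by rewrite hornerD hornerM hornerXn /M expr0n mul0r addr0 eY.
have [r ->] := meval_taylor2 (H i) Y (fun t => (u t 0)%:P) 'X^M.
rewrite dvdp_add //; last first.
  by rewrite -exprM dvdp_mulr // dvdp_exp2l // /M muln2 -addnn addSn addnS !ltnS leq_addr.
rewrite eq mulrC -mulrDr exprSr dvdp_mul // dvd_polyX hornerD horner_sum.
apply/eqP; transitivity ((\col_i (q i).[0] + J *m u) i 0).
  rewrite !mxE (eq_bigr (fun t => J i t * u t 0)) // => t _.
  by rewrite hornerM hornerC ev0 // mderiv_map_mpoly [J i t]mxE.
by rewrite /u mulmxN mulKVmx // subrr mxE.
Qed.

Lemma unisolvent_nonsingular_zeros (F : fieldType) (n k : nat)
    (sel : 'I_k -> 'X_{1..n}) (H G : 'I_n -> {mpoly {poly F}[n]})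
    (a : 'I_k -> {poly F}) (y : 'I_k -> 'I_n -> F) :
  (forall j i, (map_mpoly (horner_eval 0) (H i)).@[y j] = 0) ->
  (forall j, \matrix_(i, t) (map_mpoly (horner_eval 0) (H i))^`M(t).@[y j]
     \in unitmx) ->
  \matrix_(c, b) (\prod_t y c t ^+ sel b t) \in unitmx ->
  \sum_b a b *: 'X_[sel b] = \sum_i G i * H i ->
  forall b, a b = 0.
Proof.
move=> Hy Jy Sy eGH b.
(* A nonzero polynomial of this size is not divisible by X^N, so this single precision settles
   [b]. *)
pose N := size (a b).
have /(_ _)/constructive_indefinite_description-/all_sig [Y HY] :
  forall j, exists Y : 'I_n -> {poly F},
    (forall t, (Y t).[0] = y j t) /\ (forall i, 'X^N %| (H i).@[Y]).
  by move=> j; apply: hensel_poly.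
pose S := \matrix_(c, b) (\prod_t Y c t ^+ sel b t).
have dvdS c : 'X^N %| (S *m \col_b a b) c 0.
  have -> : (S *m \col_b a b) c 0 = (\sum_b a b *: 'X_[sel b]).@[Y c].
    rewrite mxE raddf_sum; apply: eq_bigr => e _.
    by rewrite !mxE /= mevalZ mevalX mulrC.
  rewrite eGH raddf_sum; apply: (big_ind (dvdp 'X^N)) => [|p1 p2|i _]; first exact: dvdp0.
    exact: dvdp_add.
  by rewrite /= mevalM dvdp_mull //; case: (HY c).
(* Cramer's rule, through the adjugate. *)
have dvda : 'X^N %| \det S * a b.
  have -> : \det S * a b = (\adj S *m (S *m \col_b a b)) b 0.
    by rewrite mulmxA mul_adj_mx mul_scalar_mx !mxE.
  rewrite mxE; apply: (big_ind (dvdp 'X^N)) => [|p1 p2|i _]; first exact: dvdp0.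
    exact: dvdp_add.
  by rewrite dvdp_mull.
(* At 0, [S] becomes the matrix assumed invertible, so det S is coprime to X. *)
have S0 : (\det S).[0] != 0.
  rewrite -[_.[0]]/(horner_eval 0 _) -det_map_mx -unitfE -/(_ \in unitmx).
  have -> : map_mx (horner_eval 0) S = \matrix_(c, b) (\prod_t y c t ^+ sel b t).
    apply/matrixP => c e; rewrite !mxE rmorph_prod; apply: eq_bigr => t _.
    by rewrite rmorphXn /=; case: (HY c) => <-.
  exact: Sy.
move: dvda; rewrite Gauss_dvdpr; last first.
  by rewrite coprimep_expl // coprimep_sym coprimepX.
by move=> /dvdp_leq le; apply/eqP; apply: contraT => /le; rewrite size_polyXn ltnn.
Qed.

(** * Clearing denominators *)

Lemma tofrac_inj (R : idomainType) : injective (@tofrac R).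
Proof. by move=> a b /eqP; rewrite tofrac_eq => /eqP. Qed.

Lemma fraction_numden (R : idomainType) (x : {fraction R}) :
  exists a b : R, b != 0 /\ tofrac b * x = tofrac a.
Proof.
elim/quotW: x => r; exists \n_r, \d_r; split; first exact: denom_ratioP.
apply/eqP; rewrite -[_ * _]/(FracField.mul _ _) !piE FracField.equivfE /FracField.mulf.
by rewrite !numden_Ratio ?mulf_neq0 ?oner_eq0 ?denom_ratioP //; apply/eqP; ring.
Qed.

Section ClearDenominators.
Variables (R : idomainType) (Q : R -> Prop).
Hypothesis Q1 : Q 1.
Hypothesis QM : forall a b, Q a -> Q b -> Q (a * b).

(** The product of the individual denominators works. [Q] is a multiplicative set, used both for
    nonzero polynomials and for those not vanishing at [ps]. *)
Lemma common_denominator (s : seq {fraction R}) :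
  (forall c, c \in s -> exists a b, Q b /\ tofrac b * c = tofrac a) ->
  exists D, Q D /\ forall c, c \in s -> exists a, tofrac D * c = tofrac a.
Proof.
elim: s => [|c s IH] hs; first by exists 1.
have [|D [QD hD]] := IH; first by move=> e he; apply: hs; rewrite inE he orbT.
have [|a [b [Qb hb]]] := hs c; first by rewrite inE eqxx.
exists (D * b); split=> [|e]; first exact: QM.
rewrite inE rmorphM => /orP[/eqP ->|/hD [a' ha']].
  by exists (D * a); rewrite -mulrA hb rmorphM.
by exists (b * a'); rewrite mulrAC mulrC ha' rmorphM.
Qed.

Lemma clear_denominators (n r : nat) (g : 'I_r -> {mpoly {fraction R}[n]}) :
  (forall i m, exists a b, Q b /\ tofrac b * (g i)@_m = tofrac a) ->
  exists (D : R) (G : 'I_r -> {mpoly R[n]}),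
    Q D /\ forall i, tofrac D *: g i = map_mpoly (@tofrac R) (G i).
Proof.
(* Only the finitely many coefficients on the supports need a denominator; the others are 0. *)
move=> hg; pose s := flatten [seq [seq (g i)@_m | m <- msupp (g i)] | i <- enum 'I_r].
have [c /flatten_mapP[i _ /mapP[m _ ->]] //|D [QD hD]] := @common_denominator s.
have coefD i m : exists a, tofrac D * (g i)@_m = tofrac a.
  have [hm|hm] := boolP (m \in msupp (g i)); last first.
    by exists 0; rewrite (memN_msupp_eq0 hm) mulr0 rmorph0.
  apply: hD; apply/flatten_mapP; exists i; rewrite ?mem_enum //.
  by apply/mapP; exists m.
exists D.
suff /(_ _)/constructive_indefinite_description-/all_sig [G hG] :
    forall i, exists G : {mpoly R[n]}, tofrac D *: g i = map_mpoly (@tofrac R) G.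
  by exists G.
move=> i; have /(_ _)/constructive_indefinite_description-/all_sig [A hA] := coefD i.
have [m hm|G hG] := @mpoly_of_coef _ _ (msize (g i)) A.
  apply/eqP; rewrite -tofrac_eq0 -hA.
  by rewrite (memN_msupp_eq0 (msize_mdeg_ge hm)) mulr0.
by exists G; apply/mpolyP => m; rewrite mcoeffZ mcoeff_map_mpoly hA hG.
Qed.

End ClearDenominators.

(** * Restricting the parameters to a line *)

(** The remainder modulo [D] gives the lowest digit, the quotient the others. *)
Lemma base_expansion_inj (D l : nat) (a b : 'I_l -> nat) :
  (forall i, a i < D)%N -> (forall i, b i < D)%N ->
  (\sum_i a i * D ^ i = \sum_i b i * D ^ i)%N -> a =1 b.
Proof.
elim: l a b => [|l IH] a b ha hb; first by move=> _ [].
have shift (e : 'I_l.+1 -> nat) :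
    (\sum_i e i * D ^ i = (\sum_(i < l) e (lift ord0 i) * D ^ i) * D + e ord0)%N.
  rewrite big_ord_recl expn0 muln1 addnC big_distrl /=; congr addn.
  by apply: eq_bigr => i _; rewrite /bump add1n expnSr mulnA.
rewrite !shift => e.
have D0 : (0 < D)%N := leq_ltn_trans (leq0n _) (ha ord0).
have e0 : a ord0 = b ord0.
  by move/(congr1 (modn^~ D)): e; rewrite /= !modnMDl !modn_small.
have e1 : (\sum_(i < l) a (lift ord0 i) * D ^ i = \sum_(i < l) b (lift ord0 i) * D ^ i)%N.
  by move/(congr1 (divn^~ D)): e; rewrite /= !divnMDl // !divn_small // !addn0.
move=> i; case: (unliftP ord0 i) => [j ->|-> //].
exact: (IH (fun i => a (lift ord0 i)) (fun i => b (lift ord0 i))).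
Qed.

(** In characteristic 0 the integers below [size p] are distinct, and they outnumber the possible
    roots. *)
Lemma poly_neq0_horner (F : numDomainType) (p : {poly F}) :
  p != 0 -> exists x, p.[x] != 0.
Proof.
move=> p0; pose s : seq F := [seq i%:R | i <- iota 0 (size p)].
have us : uniq s by rewrite map_inj_uniq ?iota_uniq //; apply/mulrIn/oner_neq0.
have : ~~ all (root p) s.
  apply/negP => /(max_poly_roots p0)/(_ us).
  by rewrite size_map size_iota ltnn.
by move=> /allPn[x _ hx]; exists x.
Qed.

(* Kronecker substitution: X_i |-> T^(D^i) keeps distinct monomials distinct. *)
Lemma mpoly_neq0_meval (F : numDomainType) (l : nat) (p : {mpoly F[l]}) :
  p != 0 -> exists v, p.@[v] != 0.
Proof.
(* The base [D] exceeds every exponent in [p], so [code] is injective on the support. *)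
move=> p0; pose D := msize p.
pose code (m : 'X_{1..l}) := (\sum_(i < l) m i * D ^ i)%N.
pose P : {poly F} := \sum_(m <- msupp p) p@_m *: 'X^(code m).
have code_inj m1 m2 : m1 \in msupp p -> m2 \in msupp p -> code m1 = code m2 -> m1 = m2.
  have small m : m \in msupp p -> forall i, (m i < D)%N.
    move=> hm i; apply: leq_ltn_trans (msize_mdeg_lt hm).
    by rewrite mdegE (bigD1 i) //= leq_addr.
  by move=> h1 h2 /(base_expansion_inj (small _ h1) (small _ h2)) e; apply/mnmP.
have [x Px] : exists x, P.[x] != 0.
  apply: poly_neq0_horner; pose m0 := mlead p.
  have m0p : m0 \in msupp p by apply: mlead_supp.
  apply: contraTneq m0p => PE; rewrite -mcoeff_eq0.
  have <- : P`_(code m0) = p@_m0.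
    rewrite coef_sum (bigD1_seq m0) ?msupp_uniq ?mlead_supp //=.
    rewrite coefZ coefXn eqxx mulr1 big1_seq ?addr0 // => m /andP[ne hm].
    rewrite coefZ coefXn; case: eqP => [/code_inj e|]; last by rewrite mulr0.
    by rewrite e ?mlead_supp ?eqxx in ne.
  by rewrite PE coef0.
exists (fun i => x ^+ (D ^ i)); move: Px.
rewrite mevalE horner_sum; under eq_bigr => m _.
  rewrite hornerZ hornerXn /code -prodrXr; under eq_bigr do rewrite mulnC exprM.
  over.
by [].
Qed.

Section SpecializationOnLine.
Variables (C : numClosedFieldType) (l : nat) (ps v : 'I_l -> C).

Definition eval_at (q : 'I_l -> C) (a : {mpoly rat[l]}) : C :=
  (map_mpoly (ratr : rat -> C) a).@[q].

(** The restriction of [a] to the line through [ps] in direction [v], with parameter ['X]; being a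
    ring morphism, it acts on coefficients through [map_mpoly]. *)
Definition line_spec (a : {mpoly rat[l]}) : {poly C} :=
  (map_mpoly (polyC \o (ratr : rat -> C)) a).@[fun i => (ps i)%:P + v i *: 'X].

Lemma line_spec_zmod_morphism : zmod_morphism line_spec.
Proof. by move=> a b; rewrite /line_spec raddfB mevalB. Qed.

Lemma line_spec_monoid_morphism : monoid_morphism line_spec.
Proof.
by split=> [|a b]; rewrite /line_spec ?rmorph1 ?meval1 // rmorphM mevalM.
Qed.

HB.instance Definition _ := GRing.isZmodMorphism.Build {mpoly rat[l]} {poly C}
  line_spec line_spec_zmod_morphism.
HB.instance Definition _ := GRing.isMonoidMorphism.Build {mpoly rat[l]} {poly C}
  line_spec line_spec_monoid_morphism.

Lemma horner_line_spec (a : {mpoly rat[l]}) (x : C) :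
  (line_spec a).[x] = eval_at (fun i => ps i + v i * x) a.
Proof.
rewrite -[LHS]/(horner_eval x _) rmorph_meval /eval_at.
have -> : map_mpoly (horner_eval x) (map_mpoly (polyC \o (ratr : rat -> C)) a)
    = map_mpoly (ratr : rat -> C) a.
  by apply/mpolyP => m; rewrite !mcoeff_map_mpoly /= /horner_eval hornerC.
by apply: meval_eq => i; rewrite /= /horner_eval hornerD hornerC hornerZ hornerX.
Qed.

End SpecializationOnLine.

(** * Values of coefficients at the special parameter [ps] *)

Lemma pevalM (l : nat) (ps : 'I_l -> CC) (a b : {mpoly rat[l]}) :
  peval (a * b) ps = peval a ps * peval b ps.
Proof. by rewrite /peval rmorphM mevalM. Qed.

Lemma peval1 (l : nat) (ps : 'I_l -> CC) : peval 1 ps = 1.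
Proof. by rewrite /peval rmorph1 meval1. Qed.

Lemma peval0 (l : nat) (ps : 'I_l -> CC) : peval 0 ps = 0.
Proof. by rewrite /peval rmorph0 meval0. Qed.

(** Cross-multiplication gives a polynomial identity; evaluated at [ps], the denominator behind [v]
    cancels. Hence the value does not depend on the fraction representing [c]. *)
Lemma coef_valueE (l : nat) (ps : 'I_l -> CC) (c : Kfield l) (v : CC)
    (D a : {mpoly rat[l]}) :
  coef_value ps c v -> tofrac D * c = tofrac a -> peval D ps * v = peval a ps.
Proof.
move=> [n [d [-> d0 ->]]].
have d1 : tofrac d != 0 :> Kfield l.
  by rewrite tofrac_eq0; apply: contraNneq d0 => ->; rewrite peval0.
move/(congr1 (fun z => z * tofrac d)); rewrite mulrA divfK // -!rmorphM /=.
move/eqP; rewrite tofrac_eq => /eqP/(congr1 (fun z => peval z ps)).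
by rewrite !pevalM => e; rewrite mulrA e mulfK.
Qed.

(** As [B] does not vanish at [ps], [H] specializes there to a nonzero multiple of the specialized
    [h], with the same nonsingular zeros. *)
Lemma specialize_denominators (l n : nat) (ps : 'I_l -> CC)
    (h : 'I_n -> {mpoly (Kfield l)[n]}) :
  (forall i, poly_defined_at ps (h i)) ->
  exists (B : {mpoly rat[l]}) (H : 'I_n -> {mpoly {mpoly rat[l]}[n]}),
    [/\ peval B ps != 0,
        forall i, tofrac B *: h i = map_mpoly (@tofrac _) (H i) &
        forall i m, peval (H i)@_m ps = peval B ps * (spec_poly ps (h i))@_m].
Proof.
move=> hdef.
have [|a b|i m|B [H [B0 BH]]] := @clear_denominators {mpoly rat[l]}
    (fun b => peval b ps != 0) _ _ n n h.
- by rewrite peval1 oner_eq0.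
- by rewrite pevalM; apply: mulf_neq0.
- have [v [a [b [-> b0 _]]]] := hdef i m; exists a, b; split=> //.
  rewrite mulrC divfK // tofrac_eq0.
  by apply: contraNneq b0 => ->; rewrite peval0.
exists B, H; split=> // i m.
have e : tofrac B * (h i)@_m = tofrac (H i)@_m.
  by rewrite -mcoeffZ BH mcoeff_map_mpoly.
rewrite mcoeff_map_mpoly_msupp; case: ifP => hm.
  by rewrite (coef_valueE _ e) //; apply: epsilon_spec; apply: hdef.
move: e; rewrite memN_msupp_eq0 ?hm // mulr0 => /esym/eqP.
by rewrite tofrac_eq0 => /eqP ->; rewrite peval0 mulr0.
Qed.

(** * Independence of the selected monomials modulo the ideal *)

(** A nonzero [a b] is nonzero at some point [q]; on the line from [ps] to [q], lifting forces it to
    vanish identically, hence at [q]. *)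
Lemma nonsingular_zeros_independent (C : numClosedFieldType) (l n k : nat)
    (ps : 'I_l -> C) (B : {mpoly rat[l]}) (H G : 'I_n -> {mpoly {mpoly rat[l]}[n]})
    (P : 'I_n -> {mpoly C[n]}) (sel : 'I_k -> 'X_{1..n}) (y : 'I_k -> 'I_n -> C)
    (a : 'I_k -> {mpoly rat[l]}) :
  eval_at ps B != 0 ->
  (forall i m, eval_at ps (H i)@_m = eval_at ps B * (P i)@_m) ->
  (forall j i, (P i).@[y j] = 0) ->
  (forall j, \matrix_(i, t) (P i)^`M(t).@[y j] \in unitmx) ->
  \matrix_(c, b) (\prod_t y c t ^+ sel b t) \in unitmx ->
  \sum_b a b *: 'X_[sel b] = \sum_i G i * H i ->
  forall b, a b = 0.
Proof.
move=> B0 BH hy Jy Sy eR b; apply/eqP; apply: contraT => ab0.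
have /mpoly_neq0_meval[q hq] : map_mpoly (ratr : rat -> C) (a b) != 0.
  apply: contraNneq ab0 => /mpolyP e; apply/eqP/mpolyP => m.
  have /eqP := e m; rewrite mcoeff_map_mpoly mcoeff0 fmorph_eq0 mcoeff0.
  by move/eqP.
(* Parameter 0 gives [ps], and parameter 1 gives [q]. *)
pose f := line_spec ps (fun i => q i - ps i).
have spec0 i : map_mpoly (horner_eval 0) (map_mpoly f (H i)) = eval_at ps B *: P i.
  apply/mpolyP => m; rewrite !mcoeff_map_mpoly mcoeffZ -BH.
  rewrite /= /horner_eval horner_line_spec /eval_at.
  by apply: meval_eq => t; rewrite mulr0 addr0.
have zeros j i : (map_mpoly (horner_eval 0) (map_mpoly f (H i))).@[y j] = 0.
  by rewrite spec0 mevalZ hy mulr0.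
have jac j : \matrix_(i, t) (map_mpoly (horner_eval 0) (map_mpoly f (H i)))^`M(t).@[y j]
    \in unitmx.
  have -> : \matrix_(i, t) (map_mpoly (horner_eval 0) (map_mpoly f (H i)))^`M(t).@[y j]
      = eval_at ps B *: \matrix_(i, t) (P i)^`M(t).@[y j].
    by apply/matrixP => i t; rewrite !mxE spec0 mderivZ mevalZ.
  by rewrite unitmxZ ?unitfE.
have ef : \sum_b f (a b) *: 'X_[sel b] = \sum_i map_mpoly f (G i) * map_mpoly f (H i).
  move/(congr1 (map_mpoly f)): eR; rewrite !raddf_sum /=.
  under eq_bigr do rewrite map_mpolyZ map_mpolyX.
  by under [in RHS]eq_bigr do rewrite rmorphM.
have := unisolvent_nonsingular_zeros zeros jac Sy ef b.
move/(congr1 (fun p => p.[1])); rewrite horner0 horner_line_spec => e.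
case/eqP: hq; rewrite -[RHS]e /eval_at; apply: meval_eq => t.
by rewrite mulr1 subrKC.
Qed.

Lemma independent_mod_ideal (l n k : nat) (ps : 'I_l -> CC)
    (h : 'I_n -> {mpoly (Kfield l)[n]}) (sel : 'I_k -> 'X_{1..n})
    (y : 'I_k -> 'I_n -> CC) :
  (forall i, poly_defined_at ps (h i)) ->
  (forall j i, (spec_poly ps (h i)).@[y j] = 0) ->
  (forall j, \matrix_(i, t) (spec_poly ps (h i))^`M(t).@[y j] \in unitmx) ->
  \matrix_(c, b) (\prod_t y c t ^+ sel b t) \in unitmx ->
  forall c : 'I_k -> Kfield l,
    in_ideal h (\sum_b c b *: 'X_[sel b]) -> forall b, c b = 0.
Proof.
move=> hdef hy Jy Sy c [g eg].
have [B [H [B0 BH BHps]]] := specialize_denominators hdef.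
have tB0 : (tofrac B : Kfield l) != 0.
  by rewrite tofrac_eq0; apply: contraNneq B0 => ->; rewrite peval0.
have frac0 (x : Kfield l) : exists a b, b != 0 /\ tofrac b * x = tofrac a.
  exact: fraction_numden.
have mul0 (a b : {mpoly rat[l]}) : a != 0 -> b != 0 -> a * b != 0 by exact: mulf_neq0.
(* The inverse of [B] compensates for the replacement of h by B h. Unlike [B], the denominators [D]
   and [D'] may vanish at [ps]. *)
have [||i m|D [G [D0 DG]]] := @clear_denominators {mpoly rat[l]}
    (fun b => b != 0) _ _ n n (fun i => (tofrac B)^-1 *: g i).
- exact: oner_neq0.
- exact: mul0.
- exact: frac0.
have [||x _|D' [D'0 DC]] := @common_denominator {mpoly rat[l]}
    (fun b => b != 0) _ _ (codom c).
- exact: oner_neq0.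
- exact: mul0.
- exact: frac0.
have /(_ _)/constructive_indefinite_description-/all_sig [a ea] :
    forall b, exists a, tofrac D' * c b = tofrac a.
  by move=> b; apply: DC; apply: codom_f.
suff a0 b : D * a b = 0.
  move=> b; have /eqP := a0 b; rewrite mulf_eq0 (negPf D0) /= => /eqP ab0.
  have /eqP := ea b; rewrite ab0 rmorph0 mulf_eq0 tofrac_eq0 (negPf D'0).
  by move/eqP.
(* The relation multiplied by D D', with each term factored as D' (D g / B) (B h). *)
have eR : \sum_b (D * a b) *: 'X_[sel b] = \sum_i (D' *: G i) * H i.
  apply: (map_mpoly_inj (@tofrac_inj {mpoly rat[l]})).
  rewrite !raddf_sum /=.
  under eq_bigr => e _.
    rewrite map_mpolyZ map_mpolyX rmorphM /= -ea mulrA -scalerA. over.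
  rewrite -scaler_sumr eg scaler_sumr; apply: eq_bigr => i _.
  rewrite rmorphM /= map_mpolyZ -DG -BH -!scalerAl -scalerAr !scalerA.
  by rewrite divfK // mulrC.
exact: (@nonsingular_zeros_independent CC _ _ _ ps B H _ _ sel y _ B0 BHps hy Jy Sy eR).
Qed.

(** * Nonsingular solutions of the square system *)

Section NonsingularSolution.
Variables (C : numClosedFieldType) (n k : nat) (P : 'I_n -> {mpoly C[n]}).
Variable sel : 'I_k -> 'X_{1..n}.

(* [big_system ps h sel] is the instance C := CC, P i := spec_poly ps (h i). *)
Definition zeros_interpolation_system : 'rV[{mpoly C[nvars k n]}]_(nvars k n) :=
  row_mx
    (mxvec (\matrix_(j < k, i < n) (P i \mPo [tuple 'X_(yvar j t) | t < n])))
    (mxvec (\matrix_(a < k, b < k)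
       (\sum_(c < k) 'X_(lamvar n a c) * \prod_(t < n) 'X_(yvar c t) ^+ sel b t
        - (a == b)%:R))).

Let sys := zeros_interpolation_system ord0.

Variable z : 'I_(nvars k n) -> C.
Hypothesis z_sol : forall e, (sys e).@[z] = 0.
Hypothesis z_nonsing : \det (\matrix_(e, v) (mderiv v (sys e)).@[z]) != 0.

Let y j t := z (@yvar k n j t).

Lemma system_zero_equation j i :
  sys (@yvar k n j i) = P i \mPo [tuple 'X_(yvar j t) | t < n].
Proof. by rewrite /sys /zeros_interpolation_system row_mxEl mxvecE mxE. Qed.

Lemma meval_comp_yvar (p : {mpoly C[n]}) j :
  (p \mPo [tuple 'X_(yvar j t) | t < n]).@[z] = p.@[y j].
Proof.
by rewrite comp_mpoly_meval; apply: meval_eq => t; rewrite tnth_mktuple mevalXU.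
Qed.

Lemma solution_zeros j i : (P i).@[y j] = 0.
Proof.
have e := z_sol (yvar j i).
by rewrite -meval_comp_yvar -system_zero_equation.
Qed.

(** The equations Lambda S = I exhibit a left inverse of a square matrix. *)
Lemma solution_interpolation_unit :
  \matrix_(c < k, b < k) (\prod_t y c t ^+ sel b t) \in unitmx.
Proof.
suff /mulmx1_unit[] : (\matrix_(a < k, c < k) z (lamvar n a c))
  *m (\matrix_(c < k, b < k) (\prod_t y c t ^+ sel b t)) = 1%:M by [].
apply/matrixP => a b; have e := z_sol (lamvar n a b).
move: e; rewrite /sys /zeros_interpolation_system row_mxEr mxvecE mxE.
rewrite mevalB rmorph_nat => /subr0_eq; rewrite !mxE => <-; rewrite raddf_sum; apply: eq_bigr => c _.
rewrite !mxE /= mevalM mevalXU rmorph_prod; congr (_ * _); apply: eq_bigr => t _.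
by rewrite rmorphXn /= mevalXU.
Qed.

(* A left kernel vector of the block of y_j extends by zero to one of the whole
   Jacobian, as the equations of that block involve no other variables. *)
Lemma solution_jacobian_unit j :
  \matrix_(i, t) (P i)^`M(t).@[y j] \in unitmx.
Proof.
move: z_nonsing; rewrite unitmxE unitfE; apply: contraNneq => /eqP/det0P[w w0 wJ].
apply/det0P; exists (row_mx (mxvec (\matrix_(j', i) (w 0 i *+ (j' == j)))) 0).
  apply: contraNneq w0 => /rowP e; apply/eqP/rowP => i.
  by have := e (yvar j i); rewrite row_mxEl mxvecE !mxE eqxx.
apply/rowP => v; rewrite !mxE big_split_ord /= [X in _ + X]big1 ?addr0 => [|e _]; last first.
  by rewrite row_mxEr !mxE mul0r.
rewrite (reindex _ (curry_mxvec_bij _ _)) /=.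
transitivity (\sum_j' \sum_i (w 0 i *+ (j' == j)) * (sys (yvar j' i))^`M(v).@[z]).
  by rewrite pair_bigA /=; apply: eq_bigr => [[j' i] _] /=; rewrite row_mxEl mxvecE !mxE.
rewrite (bigD1 j) //= [X in _ + X]big1 ?addr0 => [|j' jj']; last first.
  by apply: big1 => i _; rewrite (negPf jj') mul0r.
under eq_bigr => i _.
  rewrite eqxx mulr1n system_zero_equation.
  rewrite mderiv_comp_mpoly raddf_sum big_distrr /=. over.
(* By the chain rule, the derivative of the t-th variable is multiplied by the t-th entry of w J,
   which is 0. *)
rewrite exchange_big big1 //= => t _.
under eq_bigr => i _ do rewrite mevalM meval_comp_yvar mulrA.
rewrite -big_distrl /=; move/rowP/(_ t): wJ; rewrite !mxE => e.
rewrite (eq_bigr (fun i => w 0 i * (\matrix_(i, t) (P i)^`M(t).@[y j]) i t)).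
  by rewrite e mul0r.
by move=> i _; rewrite mxE.
Qed.

End NonsingularSolution.

(** * Lower bounds on the Hilbert function *)

(** Exponent vectors inject into the n-tuples over 0..d of sum at most d, which number C(n + d,
    n). *)
Lemma card_bmultinom_le (n d : nat) : (#|{: 'X_{1..n < d.+1}}| <= 'C(n + d, d))%N.
Proof.
have <- : 'C(n + d, n) = 'C(n + d, d).
  by rewrite -(bin_sub (leq_addl n d)) addnK.
rewrite -card_partial_ord_partitions.
pose f (m : 'X_{1..n < d.+1}) : n.-tuple 'I_d.+1 := [tuple inord (m i) | i < n].
have fE (m : 'X_{1..n < d.+1}) i : tnth (f m) i = m i :> nat.
  rewrite tnth_mktuple inordK //; apply: leq_ltn_trans (bmdeg m).
  by rewrite mdegE (bigD1 i) //= leq_addr.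
have f_inj : injective f.
  move=> m1 m2 e; apply/val_inj/mnmP => i.
  by rewrite -!fE e.
rewrite -cardsT -(card_imset _ f_inj); apply/subset_leq_card/subsetP => t.
case/imsetP => m _ ->; rewrite inE big_tuple.
by under eq_bigr do rewrite fE; rewrite -mdegE -ltnS bmdeg.
Qed.

(** Vectors satisfying [P] are added greedily while one lies outside the span; the rank bound stops
    this. [P] is arbitrary, so excluded middle decides each step. *)
Lemma maximal_row_free (F : fieldType) (N : nat) (P : 'rV[F]_N -> Prop) :
  exists m (B : 'M[F]_(m, N)),
    [/\ row_free B, forall j, P (row j B) & forall v, P v -> (v <= B)%MS].
Proof.
(* [e] bounds the number of rows still to be added; at 0, [B] spans the whole space. *)
suff extend e m (B : 'M[F]_(m, N)) : (N <= m + e)%N -> row_free B ->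
    (forall j, P (row j B)) -> exists m' (B' : 'M[F]_(m', N)),
    [/\ row_free B', forall j, P (row j B') & forall v, P v -> (v <= B')%MS].
  apply: (extend N 0 0) => //; last by case.
  by rewrite /row_free mxrank0.
elim: e m B => [|e IH] m B le_N freeB PB.
  exists m, B; split=> // v _; apply: submx_full; rewrite /row_full.
  move: freeB; rewrite /row_free => /eqP rB.
  by rewrite eqn_leq rank_leq_col rB -[m]addn0.
have [[v [Pv vB]]|all_in] := classic (exists v, P v /\ ~ (v <= B)%MS); last first.
  exists m, B; split=> // v Pv; apply/negPn/negP => vB.
  by apply: all_in; exists v; split=> //; apply/negP.
apply: (IH (m + 1)%N (col_mx B v)); first by rewrite -addnA add1n.
  rewrite /row_free eqn_leq rank_leq_row /= [X in (X <= _)%N]addn1.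
  have : (B < B + v)%MS.
    by rewrite /ltmx addsmxSl addsmx_sub submx_refl /=; apply/negP.
  by rewrite ltmxErank (eqP freeB) => /andP[_]; rewrite addsmxE.
move=> j; rewrite -(splitK j); case: (split j) => i /=.
  by rewrite rowKu.
rewrite rowKd; have -> : row i v = v by apply/rowP => t; rewrite mxE ord1.
exact: Pv.
Qed.

Section HilbertFunction.
Variables (F : fieldType) (n r : nat) (h : 'I_r -> {mpoly F[n]}) (d : nat).

Lemma in_ideal_sum (I : finType) (c : I -> F) (f : I -> {mpoly F[n]}) :
  (forall i, in_ideal h (f i)) -> in_ideal h (\sum_i c i *: f i).
Proof.
move=> hf; apply: (big_ind (in_ideal h)) => [|p q [g ->] [g' ->]|i _].
- by exists (fun=> 0); rewrite big1 // => i _; rewrite mul0r.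
- by exists (fun i => g i + g' i); rewrite -big_split; apply: eq_bigr => i _; rewrite mulrDl.
have [g ->] := hf i; exists (fun j => c i *: g j); rewrite scaler_sumr.
by apply: eq_bigr => j _; rewrite scalerAl.
Qed.

Lemma in_idealN (p : {mpoly F[n]}) : in_ideal h p -> in_ideal h (- p).
Proof.
move=> [g ->]; exists (fun i => - g i); rewrite -sumrN.
by apply: eq_bigr => i _; rewrite mulNr.
Qed.

(** Coordinates in the monomials of degree at most [d] turn dimensions into matrix ranks. *)
Let N := #|{: 'X_{1..n < d.+1}}|.
Let mon (i : 'I_N) : 'X_{1..n < d.+1} := enum_val i.
Let unvec (w : 'rV[F]_N) : {mpoly F[n]} := \sum_i w 0 i *: 'X_[mon i].
Let vec (p : {mpoly F[n]}) : 'rV[F]_N := \row_i p@_(mon i).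

Lemma unvecK : cancel unvec vec.
Proof.
move=> w; apply/rowP => i; rewrite mxE raddf_sum (bigD1 i) //= mcoeffZ mcoeffX eqxx.
rewrite mulr1 big1 ?addr0 // => j ji; rewrite mcoeffZ mcoeffX.
by rewrite -bmeqP (inj_eq enum_val_inj) (negPf ji) mulr0.
Qed.

Lemma vecK (p : {mpoly F[n]}) : (msize p <= d.+1)%N -> unvec (vec p) = p.
Proof.
move=> sp; rewrite [RHS](mpolywE sp) (reindex_onto _ enum_rank (fun m _ => enum_rankK m)) /=.
rewrite /unvec; apply: eq_big => [i|i _]; last by rewrite mxE.
by rewrite enum_valK eqxx.
Qed.

Lemma msize_sumZ (I : finType) (c : I -> F) (f : I -> {mpoly F[n]}) :
  (forall i, msize (f i) <= d.+1)%N -> (msize (\sum_i c i *: f i) <= d.+1)%N.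
Proof.
move=> hf; apply: (big_ind (fun p => msize p <= d.+1)%N) => [|p q hp hq|i _].
- by rewrite mmeasure0.
- by apply: leq_trans (msizeD_le p q) _; rewrite geq_max hp.
- exact: leq_trans (msizeZ_le _ _) (hf i).
Qed.

Lemma msize_bmonomial (m : 'X_{1..n < d.+1}) : (msize ('X_[m] : {mpoly F[n]}) <= d.+1)%N.
Proof. by rewrite msizeX bmdeg. Qed.

Lemma unvecD : {morph unvec : v w / v + w}.
Proof.
move=> v w; rewrite /unvec -big_split; apply: eq_bigr => i _.
by rewrite mxE scalerDl.
Qed.

Lemma unvec_mul m (c : 'rV[F]_m) (B : 'M[F]_(m, N)) :
  unvec (c *m B) = \sum_j c 0 j *: unvec (row j B).
Proof.
rewrite /unvec; under [RHS]eq_bigr do rewrite scaler_sumr.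
rewrite exchange_big; apply: eq_bigr => i _ /=.
by rewrite mxE scaler_suml; apply: eq_bigr => j _; rewrite scalerA mxE.
Qed.

(** [dim_Ile] is chosen by [epsilon], so a basis must be exhibited: a maximal free family of
    coordinate vectors of ideal members. *)
Lemma is_dim_Ile_dim_Ile : is_dim_Ile h d (dim_Ile h d).
Proof.
apply: epsilon_spec.
have [m [B [freeB hB maxB]]] := maximal_row_free (fun v => in_ideal h (unvec v)).
exists m, (fun j => unvec (row j B)); split.
- move=> j; split; first exact: hB.
  by apply: msize_sumZ => i; apply: msize_bmonomial.
- move=> c c0 j; pose w : 'rV[F]_m := \row_j c j.
  suff /rowP/(_ j) : w = 0 by rewrite !mxE.
  apply: (row_free_inj freeB); rewrite mul0mx; apply: (can_inj unvecK).
  rewrite unvec_mul /unvec [RHS]big1 => [|i _]; last by rewrite mxE scale0r.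
  by rewrite -[RHS]c0; apply: eq_bigr => i _; rewrite mxE.
move=> f hf sf; have /submxP[w ew] : (vec f <= B)%MS by apply: maxB; rewrite vecK.
exists (fun j => w 0 j).
by rewrite -(vecK sf) ew unvec_mul.
Qed.

(** A basis of the part of the ideal in degree at most [d], joined with the [k] monomials, is free
    among all polynomials of degree at most [d]. *)
Lemma HF_ge_independent (k : nat) (sel : 'I_k -> 'X_{1..n < d.+1}) :
  (forall c : 'I_k -> F, in_ideal h (\sum_b c b *: 'X_[sel b]) -> forall b, c b = 0) ->
  (k <= HF h d)%N.
Proof.
move=> indep; have [b [hb free_b _]] := is_dim_Ile_dim_Ile.
set m := dim_Ile h d in b hb free_b *.
pose A : 'M[F]_(m + k, N) :=
  col_mx (\matrix_j vec (b j)) (\matrix_e vec 'X_[sel e]).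
suff /eqP rA : row_free A.
  have le_mk : (m + k <= 'C(n + d, d))%N.
    by rewrite -rA; apply: leq_trans (rank_leq_col A) (card_bmultinom_le n d).
  (* The subtraction in [HF] is truncated, so [m] must also be bounded by the binomial. *)
  by rewrite /HF leq_subRL // (leq_trans (leq_addr k m)).
apply: inj_row_free => u uA.
have e0 : \sum_j (lsubmx u) 0 j *: b j + \sum_e (rsubmx u) 0 e *: 'X_[sel e] = 0.
  have rowA (I : nat) (f : 'I_I -> {mpoly F[n]}) :
      (forall i, msize (f i) <= d.+1)%N ->
      forall w : 'rV_I, \sum_i w 0 i *: f i = unvec (w *m \matrix_i vec (f i)).
    move=> sf w; rewrite unvec_mul; apply: eq_bigr => i _.
    by rewrite rowK vecK.
  rewrite !rowA => [|e|j]; [|exact: msize_bmonomial|by case: (hb j)].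
  rewrite -unvecD -mul_row_col hsubmxK uA.
  by rewrite /unvec big1 // => i _; rewrite mxE scale0r.
(* The monomial part is minus an ideal member, so its coefficients vanish first; freeness of the
   basis then handles the others. *)
have u2 e : (rsubmx u) 0 e = 0.
  apply: indep e; move/eqP: e0; rewrite addrC addr_eq0 => /eqP ->.
  by apply: in_idealN; apply: in_ideal_sum => j; case: (hb j).
have u1 j : (lsubmx u) 0 j = 0.
  apply: free_b j; rewrite -[RHS]e0 [X in _ = _ + X]big1 ?addr0 // => e _.
  by rewrite u2 scale0r.
rewrite -[u]hsubmxK.
have -> : lsubmx u = 0 by apply/rowP => j; rewrite u1 mxE.
have -> : rsubmx u = 0 by apply/rowP => j; rewrite u2 mxE.
by rewrite row_mx0.
Qed.

End HilbertFunction.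

Theorem theorem3p1 (l n : nat) (h : 'I_n -> {mpoly (Kfield l)[n]}) (d k : nat)
  (ps : 'I_l -> CC) (sel : 'I_k -> 'X_{1..n < d.+1}) :
  generically_radical_zerodim h ->
  injective sel ->
  (forall i, poly_defined_at ps (h i)) ->
  (exists z : 'I_(nvars k n) -> CC, nonsingular_solution (big_system ps h sel) z) ->
  (k <= HF h d)%N.
Proof.
move=> _ _ hdef [z [z_sol z_nonsing]].
pose P i := spec_poly ps (h i).
apply: HF_ge_independent.
(* The points are the y-blocks of the solution. *)
apply: (independent_mod_ideal (y := fun j t => z (yvar j t)) hdef).
- exact: (@solution_zeros CC n k P sel z z_sol).
- exact: (@solution_jacobian_unit CC n k P sel z z_nonsing).
- exact: (@solution_interpolation_unit CC n k P sel z z_sol).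
Qed.
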